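(* Let $k\ge 1$, let $0<r_1<\cdots<r_k$ be integers, let $d=\gcd(r_1,\ldots,r_k)$, and for each positive integer $n$ let $M_n=\langle n,n+r_1,\ldots,n+r_k\rangle$. The function $n\mapsto t(M_n)$ is eventually $r_k$-periodic; that is, for all sufficiently large integers $n$ with $\gcd(n,d)=1$ one has $t(M_{n+r_k})=t(M_n)$. In particular, for all sufficiently large $n$ with $\gcd(n,d)=1$, $M_n$ is symmetric if and only if $M_{n+r_k}$ is symmetric, and $M_n$ is pseudosymmetric if and only if $M_{n+r_k}$ is pseudosymmetric.
   Context: $\langle g_1,\ldots,g_m\rangle$ denotes the additive submonoid of $\mathbb Z_{\ge0}$ generated by $g_1,\ldots,g_m$. Let $M\subsetneq\mathbb Z_{\ge0}$ be an additive submonoid with $\gcd(M)=1$ (when $\gcd(n,d)=1$ one has $\gcd(M_n)=1$). An integer $m\ge0$ is a pseudo-Frobenius number of $M$ if $m\notin M$ but $m+s\in M$ for all positive $s\in M$. $PF(M)$ denotes the set of pseudo-Frobenius numbers of $M$, and the type of $M$ is $t(M)=|PF(M)|$. Let $F(M)=\max(\mathbb Z_{\ge0}\setminus M)$. $M$ is symmetric if $F(M)$ is odd and for every integer $x\notin M$ one has $F(M)-x\in M$ (equivalently $PF(M)=\{F(M)\}$). $M$ is pseudosymmetric if $F(M)$ is even and for every integer $x\notin M$ with $x\ne F(M)/2$ one has $F(M)-x\in M$ (equivalently $PF(M)=\{F(M)/2,F(M)\}$). *)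

(* Defs.v *)
From mathcomp Require Import all_boot all_order all_algebra.
From mathcomp Require Import finmap.
From mathcomp Require Import mathcomp_extra boolp classical_sets functions cardinality.

Set Implicit Arguments.
Unset Strict Implicit.
Unset Printing Implicit Defensive.

Local Open Scope classical_set_scope.
Local Open Scope nat_scope.

Definition submonoid (S : set nat) : Prop :=
  S 0 /\ forall x y, S x -> S y -> S (x + y).

Definition monoid_gen (gs : seq nat) : set nat :=
  smallest submonoid [set` gs].

Definition shifted_monoid (r : seq nat) (n : nat) : set nat :=
  monoid_gen (n :: [seq n + ri | ri <- r]).

Definition PF (M : set nat) : set nat :=
  [set m | ~ M m /\ forall s, M s -> 0 < s -> M (m + s)].

(* [fset_set] sends an infinite set to the empty one, so the next two
   definitions are meaningful when M has finitely many gaps, that is, when the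
   elements of M have gcd 1. *)
Definition monoid_type (M : set nat) : nat := #|` fset_set (PF M)|%fset.

(* The maximum is 0 in the excluded case where M is all of nat. *)
Definition Frobenius (M : set nat) : nat := \max_(x <- fset_set (~` M)) x.

(* In the next two definitions x ranges over all integers, negative ones
   included, so M is viewed as the subset [Posz @` M] of int. *)
Definition symmetric_monoid (M : set nat) : Prop :=
  odd (Frobenius M) /\
  forall x : int, ~ (Posz @` M) x ->
    (Posz @` M) (Posz (Frobenius M) - x)%R.

Definition pseudosymmetric_monoid (M : set nat) : Prop :=
  ~~ odd (Frobenius M) /\
  forall x : int, ~ (Posz @` M) x -> x <> Posz (Frobenius M)./2 ->
    (Posz @` M) (Posz (Frobenius M) - x)%R.

(* Main.v *)
(* Let R be the largest shift. The elements of M_n are the L * n + a with a a sum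
   of at most L shifts. Once a exceeds a constant, a + R is a sum of at most
   L + 1 shifts iff a is a sum of at most L. For large n, a pseudo-Frobenius
   number L * n + a therefore either has a small, and then the pair (L, a)
   works for every large n, or has a near d * n, and then
   (L, a) |-> (L + d, a + d * R) matches it with one of M_(n + R). Hence the types agree.
   Symmetry is type 1. Pseudosymmetry never occurs for large n: half of the
   Frobenius number F would be pseudo-Frobenius, but doubling a pseudo-Frobenius
   number gives too small a value in the first case and an element of M_n in
   the second. *)
Require Import Defs.
From mathcomp Require Import all_boot all_order all_algebra finmap.
From mathcomp Require Import boolp classical_sets cardinality zify.

Set Implicit Arguments.
Unset Strict Implicit.

Local Open Scope classical_set_scope.
Local Open Scope nat_scope.

(** * Submonoids of nat: gaps, Frobenius number, type and symmetry *)

Section Monoid.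
Variables (M : set nat) (M_monoid : submonoid M).

Lemma submonoidMn x k : M x -> M (k * x).
Proof.
case: M_monoid => M0 MD Mx; elim: k => [|k IHk]; first by rewrite mul0n.
by rewrite mulSn; apply: MD.
Qed.

(** Induction on the generators: with g the gcd of the tail, fewer than g copies of the head x
    correct q modulo g, and what remains is a large multiple of g. *)
Lemma submonoid_large_multiples (s : seq nat) : [set` s] `<=` M ->
  exists N, forall q, N <= q -> \big[gcdn/0]_(x <- s) x %| q -> M q.
Proof.
case: M_monoid => M0 MD; elim: s => [|x s IHs] sM.
  by exists 0 => q _; rewrite big_nil dvd0n => /eqP->.
have Mx : M x by apply: sM; rewrite /= mem_head.
have [|N HN] := IHs.
  by move=> y /= ys; apply: sM; rewrite /= inE ys orbT.
rewrite big_cons; set g := \big[gcdn/0]_(y <- s) y in HN *.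
have [g0|g_gt0] := posnP g.
  exists 0 => q _; rewrite g0 gcdn0 => /dvdnP[k ->].
  exact: submonoidMn.
exists (N + g * x) => q Nq gq.
(* [u] is chosen with [q = u * x] modulo [g]. *)
have [a _ ga] := Bezoutl x g_gt0.
have [k qE] := dvdnP gq.
pose u := (k * a * g.-1) %% g.
have ug : u < g by rewrite ltn_mod.
have uxg : u * x <= g * x by rewrite leq_mul2r (ltnW ug) orbT.
have -> : q = u * x + (q - u * x) by lia.
apply: MD; first exact: submonoidMn.
apply: HN; first lia.
rewrite -eqn_mod_dvd; last lia.
rewrite eq_sym -(eqn_modDr (k * a * x)).
have -> : q + k * a * x = k * (gcdn g x + a * x) by rewrite qE (gcdnC x); nia.
have /eqP-> : k * (gcdn g x + a * x) == 0 %[mod g].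
  by rewrite mod0n; apply: dvdn_mull.
rewrite -modnDml modnMml modnDml.
have -> : k * a * g.-1 * x + k * a * x = g * (k * a * x).
  by rewrite -[in RHS](prednK g_gt0); nia.
by rewrite mod0n modnMr.
Qed.

Variable N : nat.
Hypothesis M_cofinite : forall q, N <= q -> M q.
Hypothesis M1 : ~ M 1.

Lemma finite_gaps : finite_set (~` M).
Proof.
apply: (@sub_finite_set _ _ `I_N) (finite_II N) => x /= nMx.
by rewrite ltnNge; apply/negP => /M_cofinite.
Qed.

Lemma finite_PF : finite_set (PF M).
Proof. by apply: sub_finite_set finite_gaps => x []. Qed.

Lemma gap_le_Frobenius x : ~ M x -> x <= Frobenius M.
Proof.
move=> nMx; rewrite /Frobenius.
apply: (@leq_bigmax_seq _ _ predT id x) => //.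
by rewrite in_fset_set ?inE //; exact: finite_gaps.
Qed.

Lemma gt_Frobenius x : Frobenius M < x -> M x.
Proof. by move=> Fx; apply: contrapT => /gap_le_Frobenius; lia. Qed.

Lemma bigmax_id_mem (s : seq nat) : s != [::] -> \max_(x <- s) x \in s.
Proof.
elim: s => // x [_ _|y s /(_ isT)]; first by rewrite big_seq1 mem_head.
move=> ys _; rewrite big_cons inE.
by rewrite /maxn; case: ifP => _; rewrite ?eqxx // ys orbT.
Qed.

Lemma Frobenius_gap : ~ M (Frobenius M).
Proof.
(* The gap 1 makes the set of gaps nonempty, so the maximum is attained and is not the default 0. *)
have s1 : 1 \in (fset_set (~` M) : seq nat).
  by rewrite in_fset_set ?inE //; exact: finite_gaps.
have : Frobenius M \in (fset_set (~` M) : seq nat).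
  by apply: bigmax_id_mem; apply: contraTneq s1 => ->.
by rewrite in_fset_set ?inE //; exact: finite_gaps.
Qed.

Lemma Frobenius_PF : PF M (Frobenius M).
Proof.
split=> [|s _ s0]; first exact: Frobenius_gap.
by apply: gt_Frobenius; lia.
Qed.

(** A gap that is not pseudo-Frobenius has a larger gap x + s with s in M; the climb stops because
    gaps are bounded by [Frobenius M]. *)
Lemma gap_below_PF x : ~ M x -> exists2 s, M s & PF M (x + s).
Proof.
case: M_monoid => M0 MD.
have [m] := ubnP (Frobenius M - x); elim: m x => // m IHm x xm nMx.
have [xPF|] := pselect (PF M x); first by exists 0; rewrite ?addn0.
move=> /not_andP[/(_ nMx)//|/existsNP[s /not_implyP[Ms /not_implyP[s0 nMxs]]]].
have := gap_le_Frobenius nMxs => xsF.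
have [|t Mt] := IHm (x + s) _ nMxs; first lia.
by rewrite -addnA; exists (s + t) => //; apply: MD.
Qed.

Lemma monoid_type1P : monoid_type M = 1 <-> PF M = [set Frobenius M].
Proof.
split=> [/eqP/cardfs1P[x E]|E].
  have fE := fset_setK finite_PF.
  have PFE : PF M = [set x].
    by rewrite -fE E; apply/seteqP;
    split=> y /=; rewrite inE => /eqP.
  by have := Frobenius_PF; rewrite PFE /= => ->.
by rewrite /monoid_type E fset_set1 cardfs1.
Qed.

(** For m pseudo-Frobenius, symmetry puts F - m in M, and if positive it would put F in M.
    Conversely, climbing from a gap x must end at F, so F - x is in M. *)
Lemma symmetric_monoidP : symmetric_monoid M <-> monoid_type M = 1.
Proof.
case: (M_monoid) => M0 MD.
rewrite monoid_type1P; split=> [[_ symM]|PFE].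
  apply/seteqP; split=> [m [nMm mPF]|_ ->]; last exact: Frobenius_PF.
  have mF := gap_le_Frobenius nMm.
  have [|s Ms sE] := symM (Posz m); first by move=> [y My [yE]]; apply: nMm; rewrite -yE.
  apply: contrapT => /= mneF.
  apply: Frobenius_gap.
  have -> : Frobenius M = m + s by lia.
  by apply: mPF => //; lia.
have sym x : x <= Frobenius M -> ~ M x -> M (Frobenius M - x).
  move=> xF /gap_below_PF[s Ms]; rewrite PFE /= => <-.
  by rewrite addKn.
split.
  (* If F = h + h, then h in M puts F in M, while h outside M forces F - h = h into M. *)
  apply/negPn/negP => evF; apply: Frobenius_gap.
  have FE : Frobenius M = (Frobenius M)./2 + (Frobenius M)./2 by lia.
  have [Mh|nMh] := pselect (M (Frobenius M)./2); first by rewrite FE; apply: MD.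
  have := sym _ _ nMh; have -> : Frobenius M - (Frobenius M)./2 = (Frobenius M)./2 by lia.
  by move=> /(_ ltac:(lia)) /nMh.
case=> x nMx.
  have nMx' : ~ M x by move=> Mx; apply: nMx; exists x.
  have xF := gap_le_Frobenius nMx'.
  by exists (Frobenius M - x); [exact: sym|lia].
(* Here the integer is negative, namely -(x + 1). *)
exists (Frobenius M + x.+1); last lia.
by apply: gt_Frobenius; lia.
Qed.

(** If h + s were a gap with s > 0 in M, pseudosymmetry would put h - s in M, and adding s would put
    h in M. *)
Lemma pseudosymmetric_half_PF : pseudosymmetric_monoid M ->
  exists2 h, PF M h & Frobenius M = h + h.
Proof.
case: (M_monoid) => M0 MD [evF psym].
set h := (Frobenius M)./2 in psym.
have FE : Frobenius M = h + h by rewrite /h; lia.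
have nMh : ~ M h by move=> Mh; apply: Frobenius_gap; rewrite FE; apply: MD.
exists h => //; split=> // s Ms s0.
apply: contrapT => nMhs.
have [||y My yE] := psym (Posz (h + s)).
- by move=> [y My [yE]]; apply: nMhs; rewrite -yE.
- by move=> [hs]; lia.
have hE : h = y + s by lia.
by apply: nMh; rewrite hE; exact: MD.
Qed.

End Monoid.

(** * Sums of a bounded number of shifts *)

Section Shift.
Variables (r : seq nat) (R : nat).
Hypothesis R_in_r : R \in r.
Hypothesis r_bounds : forall x, x \in r -> 0 < x <= R.

(** The generator n itself has shift 0, so L generators of M_n involve at most L shifts, not exactly
    L. *)
Definition bounded_sum L a :=
  exists s : seq nat, [/\ all (mem r) s, size s <= L & sumn s = a].

Definition span a := exists L, bounded_sum L a.

Lemma R_gt0 : 0 < R.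
Proof. by have /andP[] := r_bounds R_in_r. Qed.

Lemma bounded_sum_span L a : bounded_sum L a -> span a.
Proof. by exists L. Qed.

Lemma bounded_sum_widen L K a : L <= K -> bounded_sum L a -> bounded_sum K a.
Proof.
move=> LK [s [sr sL sa]]; exists s; split=> //; exact: leq_trans sL LK.
Qed.

Lemma bounded_sum0 L : bounded_sum L 0.
Proof. by exists [::]. Qed.

Lemma bounded_sumD L K a b :
  bounded_sum L a -> bounded_sum K b -> bounded_sum (L + K) (a + b).
Proof.
move=> [s [sr sL <-]] [t [tr tK <-]]; exists (s ++ t).
by rewrite all_cat sr tr size_cat leq_add // sumn_cat.
Qed.

Lemma bounded_sum_gen x : x \in r -> bounded_sum 1 x.
Proof. by move=> xr; exists [:: x]; rewrite /= xr addn0. Qed.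

Lemma bounded_sumS_inv L a : bounded_sum L.+1 a ->
  bounded_sum L a \/ exists2 x, x \in r & exists2 b, bounded_sum L b & a = x + b.
Proof.
move=> [[|x s] [/= sr sL <-]]; first by left; exact: bounded_sum0.
case/andP: sr => xr sr; right; exists x => //; exists (sumn s) => //.
by exists s.
Qed.

Lemma bounded_sum_leM L a : bounded_sum L a -> a <= L * R.
Proof.
move=> [s [sr sL <-]]; apply: (@leq_trans (size s * R)); last first.
  by rewrite leq_mul2r sL orbT.
elim: s sr {sL} => //= x s IHs /andP[/r_bounds/andP[_ xR] /IHs].
by rewrite mulSn; lia.
Qed.

Lemma bounded_sum_self L a : bounded_sum L a -> bounded_sum a a.
Proof.
move=> [s [sr _ <-]]; exists s; split=> //.
elim: s sr => //= x s IHs /andP[/r_bounds/andP[x0 _] /IHs]; lia.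
Qed.

Lemma bounded_sum_dvdn d L a :
  (forall x, x \in r -> d %| x) -> bounded_sum L a -> d %| a.
Proof.
move=> dr [s [sr _ <-]].
elim: s sr => [|x s IHs] /=; first by rewrite dvdn0.
by move=> /andP[/dr dx /IHs]; apply: dvdn_add.
Qed.

Lemma span_submonoid : submonoid span.
Proof.
split; first by exists 0; exact: bounded_sum0.
by move=> a b [L La] [K Kb]; exists (L + K); exact: bounded_sumD.
Qed.

Lemma sub_span : [set` r] `<=` span.
Proof. by move=> x xr; exists 1; exact: bounded_sum_gen. Qed.

Lemma spanD a b : span a -> span b -> span (a + b).
Proof. by case: span_submonoid => _; apply. Qed.

Lemma size_le_sum_count (s t : seq nat) :
  all (mem t) s -> size s <= \sum_(x <- t) count_mem x s.
Proof.
elim: s => //= x s IHs /andP[xt /IHs sle].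
rewrite big_split /= -add1n leq_add //.
by rewrite (big_rem x xt) /= eqxx.
Qed.

(** A sum beyond this value has more than [R * size r] terms, each being at most R, so some shift
    occurs at least R times. *)
Definition threshold := R * R * size r.

(* If R does not occur in a long sum then some x occurs at least R times, and R
   copies of x can be traded for x copies of R. *)
Lemma bounded_sum_subR L a : threshold <= a ->
  bounded_sum L.+1 (a + R) -> bounded_sum L a.
Proof.
move=> a_large [s [sr sL sa]].
have R0 := R_gt0.
have [Rs|nRs] := boolP (R \in s).
  exists (rem R s); split.
  - by apply/allP => x /mem_rem xs; apply: (allP sr).
  - by rewrite size_rem // -subn1 leq_subLR add1n.
  - have := perm_sumn (perm_to_rem Rs); rewrite sa /=; lia.
have [x xr Rx] : exists2 x, x \in r & R <= count_mem x s.
  apply: contrapT => few.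
  have : size s <= size r * R.
    apply: leq_trans (size_le_sum_count sr) _.
    rewrite -sum1_size big_distrl /= !big_seq; apply: leq_sum => x xr.
    rewrite mul1n leqNgt; apply/negP => Rx; apply: few; exists x => //; exact: ltnW.
  have : sumn s <= size s * R by apply: bounded_sum_leM; exists s.
  rewrite sa; rewrite /threshold in a_large; nia.
have /andP[x0 xR] := r_bounds xr.
have /permEl/perm_sumn := perm_filterC (pred1 x) s.
have /permEl/perm_size := perm_filterC (pred1 x) s.
have -> : filter (pred1 x) s = nseq (count_mem x s) x.
  by rewrite -size_filter; apply/all_pred1P/filter_all.
rewrite size_cat sumn_cat size_nseq sumn_nseq.
set t := filter _ s; set c := count_mem x s in Rx *.
move=> /= st sut.
have {}st : @size nat t + c = @size nat s by rewrite addnC.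
have {}sut : sumn t + x * c = a + R by rewrite addnC sut.
(* Of the x copies of R obtained in the trade, one is dropped. The length falls by R - x + 1, which
   is at least 1. *)
exists (nseq (c - R) x ++ nseq x.-1 R ++ t); split.
- rewrite !all_cat !all_nseq /= xr R_in_r !orbT /=.
  by apply/allP => y; rewrite mem_filter => /andP[_ /(allP sr)].
- rewrite !size_cat !size_nseq; lia.
- rewrite !sumn_cat !sumn_nseq; nia.
Qed.

Lemma bounded_sum_addMR t L a : bounded_sum L a -> bounded_sum (L + t) (a + t * R).
Proof.
move=> La; apply: bounded_sumD => //; exists (nseq t R).
by rewrite all_nseq /= R_in_r orbT size_nseq sumn_nseq mulnC.
Qed.

Lemma bounded_sum_shift t L a : threshold <= a ->
  bounded_sum (L + t) (a + t * R) <-> bounded_sum L a.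
Proof.
move=> a_large; split; last exact: bounded_sum_addMR.
elim: t => [|t IHt]; first by rewrite mul0n !addn0.
have -> : a + t.+1 * R = a + t * R + R by lia.
rewrite addnS => LtaR; apply: IHt; apply: bounded_sum_subR => //.
exact: leq_trans a_large (leq_addr _ _).
Qed.

Lemma span_shift t a : threshold <= a -> span (a + t * R) <-> span a.
Proof.
move=> a_large; split=> -[L La]; last by exists (L + t); exact: bounded_sum_addMR.
by exists L; apply/(bounded_sum_shift t) => //; apply: bounded_sum_widen La; lia.
Qed.

Definition slack := R * (threshold + R).

(** Removing one R lowers both sides of the inequality by R. Once a is below [threshold + R], any
    sum has at most a terms, and [slack] guarantees that many. *)
Lemma span_bounded_sum L a : span a -> a + slack <= L * R -> bounded_sum L a.
Proof.
rewrite /slack; have R0 := R_gt0.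
elim/ltn_ind: a L => a IHa L Sa aL.
have [a_small|a_large] := ltnP a (threshold + R).
  case: Sa => K /bounded_sum_self; apply: bounded_sum_widen; nia.
have aE : a = (a - R) + 1 * R by lia.
have Sa' : span (a - R).
  by apply/(span_shift 1); rewrite -?aE //; lia.
case: L aL => [|L] aL; first nia.
rewrite aE -addn1; apply: bounded_sum_addMR.
by apply: IHa => //; lia.
Qed.

Lemma bounded_sum_mono L a b : span a -> a + slack <= b ->
  bounded_sum L b -> bounded_sum L a.
Proof.
by move=> Sa ab /bounded_sum_leM bL; apply: span_bounded_sum => //; lia.
Qed.

(** * The elements of M_n and the finiteness of its gaps *)

Lemma shifted_monoidP n x : shifted_monoid r n x <->
  exists L a, bounded_sum L a /\ x = L * n + a.
Proof.
split.
  pose Y := [set x | exists L a, bounded_sum L a /\ x = L * n + a].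
  apply: (@smallest_sub _ submonoid _ Y) => [|y /=].
    split=> [|y z [L [a [La ->]]] [K [b [Kb ->]]]].
      by exists 0, 0; split=> //; exact: bounded_sum0.
    by exists (L + K), (a + b); split; [exact: bounded_sumD|lia].
  rewrite inE => /orP[/eqP->|/mapP[z zr ->]].
    by exists 1, 0; split; [exact: bounded_sum0|lia].
  by exists 1, z; split; [exact: bounded_sum_gen|lia].
move=> [L [a [La ->]]] T [[T0 TD] gT] {x}.
have Tn : T n by apply: gT; rewrite /= mem_head.
elim: L a La => [|L IHL] a; first by move=> /bounded_sum_leM; case: a.
case/bounded_sumS_inv => [La|[x xr [b Lb ->]]].
  by rewrite mulSn -addnA; apply: TD => //; exact: IHL.
have -> : L.+1 * n + (x + b) = (n + x) + (L * n + b) by lia.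
apply: TD; last exact: IHL.
by apply: gT; rewrite /= inE (map_f (addn n)) ?orbT.
Qed.

Lemma shifted_monoid_submonoid n : submonoid (shifted_monoid r n).
Proof.
split=> [T [[]] //|x y Mx My T HT].
by case: (HT) => -[_ TD] _; apply: TD; [exact: Mx|exact: My].
Qed.

Lemma sub_shifted_monoid n : [set` n :: [seq n + x | x <- r]] `<=` shifted_monoid r n.
Proof. exact: sub_gen_smallest. Qed.

Local Notation d := (\big[gcdn/0]_(x <- r) x).

Lemma dvdn_big_gcd x : x \in r -> d %| x.
Proof. by move=> xr; rewrite (big_rem x xr) /=; exact: dvdn_gcdl. Qed.

Lemma dvdn_span a : span a -> d %| a.
Proof. by case=> L; apply: bounded_sum_dvdn; exact: dvdn_big_gcd. Qed.

Lemma big_gcd_gt0 : 0 < d.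
Proof. exact: dvdn_gt0 R_gt0 (dvdn_big_gcd R_in_r). Qed.

Lemma shifted_monoid_cofinite n : coprime n d ->
  exists N, forall q, N <= q -> shifted_monoid r n q.
Proof.
move=> n_d.
have [N HN] := submonoid_large_multiples (shifted_monoid_submonoid n)
  (@sub_shifted_monoid n).
exists N => q /HN; apply.
rewrite big_cons big_map; set g := gcdn _ _.
(* A common divisor of n and all n + x divides every difference x, hence divides gcd(n, d) = 1. *)
suff : g %| 1 by rewrite dvdn1 => /eqP->; exact: dvd1n.
rewrite -(eqP n_d) dvdn_gcd dvdn_gcdl /= big_seq.
apply: (big_ind (fun y => g %| y)) => [||x xr]; first exact: dvdn0.
  by move=> x y gx gy; rewrite dvdn_gcd gx gy.
have gn : g %| n by exact: dvdn_gcdl.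
rewrite -(dvdn_addr _ gn); apply: dvdn_trans (dvdn_gcdr _ _) _.
by rewrite (big_rem x xr) /=; exact: dvdn_gcdl.
Qed.

(** * Membership and pseudo-Frobenius numbers for large n *)

Variable N0 : nat.
Hypothesis span_large : forall q, N0 <= q -> d %| q -> span q.

(** The first bound lets a change of n in a sum absorb [slack] and [N0], the second keeps small sums
    below d * n, the third provides a large explicit gap. *)
Definition large n := [/\ slack + N0 + 2 * R < n, threshold + R < n &
  (2 * threshold + 2) * R + 1 < n].

(* The element L * n + a is also (L + d) * n + (a - d * n). *)
Definition low n L a := bounded_sum L a \/ d * n <= a /\ span (a - d * n).

Lemma shifted_monoid_low n L a : large n -> coprime n d -> bounded_sum L.+1 a ->
  shifted_monoid r n (L * n + a) <-> low n L a.
Proof.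
move=> [n_large _ _] n_d La; have d0 := big_gcd_gt0; have R0 := R_gt0.
have n_dn : n <= d * n by rewrite leq_pmull.
have Sa := bounded_sum_span La.
split=> [/shifted_monoidP[K [b [Kb E]]]|[{}La|[dna Sadn]]]; last 2 first.
- by apply/shifted_monoidP; exists L, a.
- apply/shifted_monoidP; exists (L + d), (a - d * n); split; last by nia.
  apply: (@bounded_sum_widen L.+1); first lia.
  by apply: bounded_sum_mono La => //; lia.
(* If K < L, then b exceeds a by at least n > [slack], so a needs no more summands than b. *)
have [KL|LK] := leqP K L.
  left; apply: (bounded_sum_widen KL).
  have [KE|KneL] := eqVneq K L.
    by have -> : a = b by move: E; rewrite KE; lia.
  apply: bounded_sum_mono Kb => //.
  have : n <= (L - K) * n by rewrite leq_pmull; lia.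
  by rewrite mulnBl; nia.
right.
have aE : a = b + (K - L) * n by rewrite mulnBl; nia.
have Sb := bounded_sum_span Kb.
(* Both a and b are multiples of d, and n is coprime to d. *)
have : d %| K - L.
  rewrite -(@Gauss_dvdl _ _ n); last by rewrite coprime_sym.
  by rewrite -(dvdn_addr _ (dvdn_span Sb)) -aE; exact: dvdn_span.
case/dvdnP=> -[|j] KLE; first lia.
have aE' : a = d * n + (b + d * (j * n)) by rewrite aE KLE; nia.
split; first by rewrite aE' leq_addr.
rewrite aE' addKn; apply: spanD => //.
case: j {KLE aE'} => [|j]; first by rewrite mul0n muln0; case: span_submonoid.
apply: span_large; last exact: dvdn_mulr.
by nia.
Qed.

(** The pair (L, a) encodes x = L * n + a. The clauses say that x + n is in M_n, that x is not, and
    that x + (n + y) is for each shift y; testing generators suffices. *)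
Definition PF_pairs n : set (nat * nat) :=
  [set p | [/\ bounded_sum p.1.+1 p.2, ~ low n p.1 p.2 &
               forall x, x \in r -> low n p.1.+1 (p.2 + x)]].

Lemma shifted_monoid_inv n s : shifted_monoid r n s -> 0 < s ->
  exists2 t, shifted_monoid r n t & s = n + t \/ exists2 x, x \in r & s = n + x + t.
Proof.
move=> /shifted_monoidP[[|L] [a [La ->]]].
  by have := bounded_sum_leM La; case: a La.
move=> _; case/bounded_sumS_inv: La => [La|[x xr [b Lb ->]]].
  exists (L * n + a); last by left; lia.
  by apply/shifted_monoidP; exists L, a.
exists (L * n + b); first by apply/shifted_monoidP; exists L, b.
by right; exists x => //; lia.
Qed.

Lemma PF_shifted_monoid n : large n -> coprime n d ->
  PF (shifted_monoid r n) = [set p.1 * n + p.2 | p in PF_pairs n].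
Proof.
move=> n_large n_d; have [M0 MD] := shifted_monoid_submonoid n.
have n0 : 0 < n by case: n_large; lia.
have lowP := shifted_monoid_low n_large n_d.
have addP L a x : bounded_sum L.+1 a -> x \in r ->
    shifted_monoid r n (L * n + a + (n + x)) <-> low n L.+1 (a + x).
  move=> La xr; rewrite -lowP; last first.
    by rewrite -[L.+2]addn1; apply: bounded_sumD => //; exact: bounded_sum_gen.
  by have -> : L * n + a + (n + x) = L.+1 * n + (a + x) by lia.
apply/seteqP; split=> [x [nMx xPF]|_ [[L a] /= [La nlow lowr]] <-].
  (* A representation of x + n > 0 uses L + 1 generators for some L; this L and its a encode x. *)
  have /shifted_monoidP[[|L] [a [La E]]] : shifted_monoid r n (x + n).
    by apply: xPF => //; apply: sub_shifted_monoid; rewrite /= mem_head.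
    by have := bounded_sum_leM La; lia.
  have xE : x = L * n + a by lia.
  exists (L, a) => //; split=> //= [|y yr]; first by rewrite -lowP -?xE.
  rewrite -addP // -xE; apply: xPF; last lia.
  by apply: sub_shifted_monoid; rewrite /= inE (map_f (addn n)) ?orbT.
split=> [|s Ms s0]; first by rewrite lowP.
have [t Mt [->|[x xr ->]]] := shifted_monoid_inv Ms s0; rewrite addnA; apply: MD => //.
  by apply/shifted_monoidP; exists L.+1, a; split=> //; lia.
by rewrite addP //; exact: lowr.
Qed.

(** If a < b encode the same number, then K < L and b exceeds a by at least n. Hence a is a sum of
    at most K + 1 <= L shifts, contradicting that it is not low. *)
Lemma PF_pairs_inj n : large n ->
  {in PF_pairs n &, injective (fun p => p.1 * n + p.2)}.
Proof.
case=> n_large _ _.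
suff le (L K a b : nat) : PF_pairs n (L, a) -> PF_pairs n (K, b) ->
    L * n + a = K * n + b -> b <= a.
  move=> [L a] [K b]; rewrite !inE => La Kb /= E.
  have ab : a = b by apply/eqP; rewrite eqn_leq (le L K a b) // (le K L b a).
  by congr pair => //; nia.
move=> [/= La nlow _] [/= Kb _ _] E; rewrite leqNgt; apply/negP => ab.
have KL : K < L by nia.
apply: nlow; left; apply: (bounded_sum_widen KL).
apply: bounded_sum_mono Kb; first exact: bounded_sum_span La.
have : n <= (L - K) * n by rewrite leq_pmull; lia.
by rewrite mulnBl; nia.
Qed.

(** Otherwise a + R would be a sum of at most L + 1 shifts, and removing R would make a low. *)
Lemma PF_pairs_large n L a : PF_pairs n (L, a) -> threshold <= a -> d * n <= a + R.
Proof.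
move=> [/= _ nlow /(_ R R_in_r)[LaR|[]//]] a_large.
by case: nlow; left; exact: bounded_sum_subR.
Qed.

(** * Passage from n to n + R *)

Lemma low_shift n L a : threshold <= a ->
  low (n + R) (L + d) (a + d * R) <-> low n L a.
Proof.
move=> a_large; rewrite /low mulnDr leq_add2r subnDr.
by rewrite bounded_sum_shift.
Qed.

Lemma low_below n L a : threshold + R < n -> a < threshold + R ->
  low n L a <-> bounded_sum L a.
Proof.
move=> n_large a_small; split=> [[//|[]]|]; last by left.
have : n <= d * n by rewrite leq_pmull ?big_gcd_gt0.
lia.
Qed.

Definition shift_pair (p : nat * nat) :=
  if p.2 < threshold then p else (p.1 + d, p.2 + d * R).

Lemma shift_pair_inj : injective shift_pair.
Proof.
move=> [L a] [K b]; rewrite /shift_pair /=.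
by case: ltnP => aT; case: ltnP => bT [E1 E2]; congr pair; lia.
Qed.

(** Here a and every a + x stay below [threshold + R], where being low does not depend on n. *)
Lemma PF_pairs_small n m L a : threshold + R < n -> threshold + R < m ->
  a < threshold -> PF_pairs n (L, a) -> PF_pairs m (L, a).
Proof.
move=> n_large m_large aT [/= La nlow lowr]; split=> //=.
  by move: nlow; rewrite !low_below //; lia.
move=> x xr; have /andP[_ xR] := r_bounds xr.
by have := lowr x xr; rewrite !low_below //; lia.
Qed.

Lemma PF_pairs_shift n L a : threshold <= a ->
  PF_pairs (n + R) (L + d, a + d * R) <-> PF_pairs n (L, a).
Proof.
move=> aT; rewrite /PF_pairs /= -addSn.
have sumE := bounded_sum_shift d L.+1 aT; have lowE := low_shift n L aT.
have lowrE x : low (n + R) (L.+1 + d) (a + d * R + x) <-> low n L.+1 (a + x).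
  by rewrite addnAC low_shift // (leq_trans aT) ?leq_addr.
split=> -[La nlow lowr]; split=> [||x xr].
- exact/sumE.
- by move/lowE.
- exact/lowrE/lowr.
- exact/sumE.
- by move/lowE.
- exact/lowrE/lowr.
Qed.

Lemma PF_pairs_image n : large n ->
  PF_pairs (n + R) = [set shift_pair p | p in PF_pairs n].
Proof.
move=> [n_slack n_thr _]; have d0 := big_gcd_gt0; have R0 := R_gt0.
have m_thr : threshold + R < n + R by lia.
apply/seteqP; split=> [[L a] La|_ [[L a] La <-]]; last first.
  rewrite /shift_pair /=; case: ltnP => aT; last exact/PF_pairs_shift.
  exact: PF_pairs_small La.
have [aT|aT] := ltnP a threshold.
  by exists (L, a); [exact: PF_pairs_small La|rewrite /shift_pair /= aT].
have n_dn : n <= d * n by rewrite leq_pmull.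
have aR := PF_pairs_large La aT.
have adR : threshold + d * R <= a by nia.
(* Strictness is what gives d <= L: otherwise a <= (L + 1) * R <= d * R < [threshold + d * R]. *)
have thr0 : 0 < threshold.
  by rewrite /threshold !muln_gt0 R0 /=; case: (r) R_in_r.
have LR : a <= L.+1 * R by case: La => /= /bounded_sum_leM.
have dL : d <= L by rewrite leqNgt; apply/negP => Ld; nia.
exists (L - d, a - d * R).
  by rewrite -PF_pairs_shift ?subnK //; lia.
by rewrite /shift_pair /= ltnNge (_ : threshold <= a - d * R) /= ?subnK //; lia.
Qed.

(** * Failure of pseudosymmetry for large n *)

Lemma shifted_monoid_gap n L : L * R + 1 < n -> ~ shifted_monoid r n (L * n + L * R + 1).
Proof.
move=> n_large /shifted_monoidP[K [a [/bounded_sum_leM aR E]]].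
(* At most L generators reach at most L * n + L * R; more give at least (L + 1) * n. *)
by have [KL|LK] := leqP K L; nia.
Qed.

Lemma not_pseudosymmetric n : large n -> coprime n d ->
  ~ pseudosymmetric_monoid (shifted_monoid r n).
Proof.
move=> n_large n_d; have [n_slack n_thr n_gap] := n_large.
have d0 := big_gcd_gt0; have R0 := R_gt0.
have M_mon := shifted_monoid_submonoid n.
have [N HN] := shifted_monoid_cofinite n_d.
have M1 : ~ shifted_monoid r n 1.
  by have := @shifted_monoid_gap n 0; apply; lia.
have nMF := Frobenius_gap HN M1.
move=> /(pseudosymmetric_half_PF M_mon HN M1)[h].
rewrite PF_shifted_monoid // => -[[L a] La /= <-] FE.
have [aT|aT] := ltnP a threshold.
  have LT : L < threshold.
    apply: (leq_ltn_trans _ aT); rewrite leqNgt; apply/negP => aL.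
    case: La => /= /bounded_sum_self La nlow _; apply: nlow; left.
    exact: bounded_sum_widen (ltnW aL) La.
  (* The gap with [2 * threshold + 2] as its L exceeds 2 * (L * n + a), since L and a are below
     [threshold]. *)
  have := gap_le_Frobenius HN (shifted_monoid_gap n_gap).
  by rewrite FE; nia.
have aR := PF_pairs_large La aT.
have n_dn : n <= d * n by rewrite leq_pmull.
case: La => /= La _ _; have aL := bounded_sum_leM La.
have da := bounded_sum_dvdn dvdn_big_gcd La.
apply: nMF; rewrite FE; apply/shifted_monoidP.
(* Trading d * n for d more summands n leaves room for a shorter sum. *)
exists (L + L + d), (a + a - d * n); split; last by nia.
apply: span_bounded_sum; last by nia.
apply: span_large; first lia.
by rewrite dvdn_sub ?dvdn_add // dvdn_mulr.
Qed.

End Shift.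

(** * Periodicity of the type and its consequences *)

Theorem corollary4p9 (k : nat) (hk : 1 <= k) (r : k.-tuple nat)
    (hr : path ltn 0 r) :
  let rk := last 0 r in
  let d := \big[gcdn/0]_(ri <- r) ri in
  let M := shifted_monoid r in
  exists N : nat, forall n : nat, N <= n -> coprime n d ->
    [/\ monoid_type (M (n + rk)) = monoid_type (M n),
        symmetric_monoid (M n) <-> symmetric_monoid (M (n + rk))
      & pseudosymmetric_monoid (M n) <-> pseudosymmetric_monoid (M (n + rk))].
Proof.
move=> rk d M.
have rk_r : rk \in (r : seq nat).
  rewrite /rk; case: (r) hk => -[|x s] /= /eqP<- // _.
  exact: mem_last.
have r_bounds x : x \in (r : seq nat) -> 0 < x <= rk.
  move=> xr; rewrite (allP (order_path_min ltn_trans hr)) //=.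
  rewrite /rk; move: xr hr; case/splitPr: _ / => s t.
  rewrite last_cat /= cat_path /= => /and3P[_ _ /(order_path_min ltn_trans)/allP xt].
  have := mem_last x t; rewrite inE => /orP[/eqP-> //|/xt]; exact: ltnW.
have [N0 span_large] := submonoid_large_multiples (span_submonoid r) (@sub_span r).
pose thr := threshold r rk.
exists (slack r rk + N0 + 2 * rk + thr + (2 * thr + 2) * rk + 2) => n n_large n_d.
have nL : large r rk N0 n by split; rewrite -?/thr; lia.
have mL : large r rk N0 (n + rk) by split; rewrite -?/thr; lia.
have m_d : coprime (n + rk) d.
  have /dvdnP[q ->] : d %| rk by exact: dvdn_big_gcd.
  by rewrite addnC /coprime gcdnC gcdnMDl gcdnC.
have [N HN] := shifted_monoid_cofinite n_d.
have [N' HN'] := shifted_monoid_cofinite m_d.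
have M1 m : 1 < m -> ~ M m 1.
  by move=> m1; apply: (shifted_monoid_gap rk_r r_bounds (n := m) (L := 0)).
have PF_card m : large r rk N0 m -> coprime m d -> (PF (M m) #= PF_pairs r m)%card.
  move=> m_large co_md; rewrite /M (PF_shifted_monoid rk_r r_bounds span_large) //.
  exact: inj_card_eq (PF_pairs_inj rk_r r_bounds m_large).
have type_eq : monoid_type (M (n + rk)) = monoid_type (M n).
  (* Both PF sets have the cardinality c of the one for n, through the pairs and [shift_pair]. *)
  have /finite_setP[c PFc] := finite_PF HN.
  rewrite /monoid_type (card_fset_set PFc); apply: card_fset_set.
  apply: card_eq_trans PFc; apply: card_eq_trans (PF_card _ mL m_d) _.
  rewrite (PF_pairs_image rk_r r_bounds nL) card_eq_sym.
  apply: card_eq_trans (PF_card _ nL n_d) _; rewrite card_eq_sym.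
  by apply: inj_card_eq => p q _ _; exact: shift_pair_inj.
have nM1 : ~ M n 1 by apply: M1; case: nL; lia.
have mM1 : ~ M (n + rk) 1 by apply: M1; case: mL; lia.
split=> //.
- rewrite (symmetric_monoidP (shifted_monoid_submonoid _ _) HN nM1).
  by rewrite (symmetric_monoidP (shifted_monoid_submonoid _ _) HN' mM1) -/M type_eq.
- have nps := not_pseudosymmetric rk_r r_bounds span_large.
  (* Neither monoid is pseudosymmetric, so both implications are vacuous. *)
  by split=> ?; [have [] := nps _ nL n_d|have [] := nps _ mL m_d].
Qed.
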